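(* Let $\bar x\in\mathbb{R}^2$ be a non-zero vector and $R_\theta$ a rotation in the plane with center $O$ and angle $\theta\in(0,\pi]$. If $S\subset\mathbb{R}^2$ is a non-empty set such that - $S$ has a finite number of points in any ball; - $S+\bar x\subset S$; - $R_\theta(S)\subset S$, then $S+\bar x=S$, $R_\theta(S)=S$ and $\theta\in\{\frac{\pi}{3},\frac{\pi}{2},\frac{2}{3}\pi,\pi\}$.
   Context: For $S\subset\mathbb{R}^2$ and $\bar x\in\mathbb{R}^2$, $S+\bar x:=\{x+\bar x:x\in S\}$. $O\in\mathbb{R}^2$ is a point, taken to be the origin. *)

(* Defs.v *)
From mathcomp Require Import all_boot all_order all_algebra.
From mathcomp Require Import all_classical all_reals all_analysis.
Set Implicit Arguments.
Unset Strict Implicit.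
Unset Printing Implicit Defensive.
Import Order.TTheory GRing.Theory Num.Theory.
Local Open Scope classical_set_scope.
Local Open Scope ring_scope.

(* The canonical norm on matrices is the sup norm, so [ball] would denote
   squares; Euclidean discs are defined separately. *)
Definition euclidean_norm (R : realType) (v : 'cV[R]_2) : R :=
  Num.sqrt (\sum_(i < 2) v i 0 ^+ 2).

Definition disc (R : realType) (c : 'cV[R]_2) (r : R) : set 'cV[R]_2 :=
  [set v | euclidean_norm (v - c) < r].

Definition translate (R : realType) (S : set 'cV[R]_2) (x : 'cV[R]_2) :
    set 'cV[R]_2 :=
  [set y + x | y in S].

Definition rotation_mx (R : realType) (theta : R) : 'M[R]_2 :=
  \matrix_(i < 2, j < 2)
    if i == j then cos theta else if i == 0 then - sin theta else sin theta.

(* Counterclockwise rotation about the origin. *)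
Definition rotation (R : realType) (theta : R) (v : 'cV[R]_2) : 'cV[R]_2 :=
  rotation_mx theta *m v.

(* Main.v *)
(* The set M of vectors w with S + w `<=` S is locally finite and stable under
   addition and rotation. By local finiteness every vector of M (and every point
   of S) is periodic under the rotation; the sum over a period is fixed by the
   rotation, hence zero, so M is stable under opposite. Since
   R w + R^-1 w = (2 cos theta) w, the group M is also stable under
   multiplication by t = 2 cos theta, hence by the powers of its fractional part.
   These powers keep xbar in a disc, so local finiteness forces t to be
   an integer. *)
Require Import Defs.
From mathcomp Require Import all_boot all_order all_algebra.
From mathcomp Require Import all_classical all_reals all_analysis.
From mathcomp Require Import ring lra.
Import Order.TTheory GRing.Theory Num.Theory.
Local Open Scope classical_set_scope.
Local Open Scope ring_scope.

Lemma finite_set_collision {T : Type} (F : set T) (f : nat -> T) :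
  finite_set F -> (forall n, F (f n)) ->
  exists i j : nat, (i < j)%N /\ f i = f j.
Proof.
move=> finF Ff; apply: contrapT => noncoll.
apply: infinite_nat.
have -> : [set: nat] = f @^-1` F by apply/seteqP; split=> n _ //=.
apply: finite_preimage finF => i j _ _ fij.
have [lt_ij|lt_ji|//] := ltngtP i j; case: noncoll.
- by exists i, j.
- by exists j, i.
Qed.

(** * Euclidean norm and plane rotations *)

Lemma euclidean_normZ {R : realType} (a : R) (v : 'cV[R]_2) :
  euclidean_norm (a *: v) = `|a| * euclidean_norm v.
Proof.
rewrite /euclidean_norm -sqrtr_sqr -sqrtrM ?sqr_ge0// mulr_sumr.
by congr Num.sqrt; apply: eq_bigr => i _; rewrite mxE exprMn.
Qed.

Lemma euclidean_norm_ge0 {R : realType} (v : 'cV[R]_2) : 0 <= euclidean_norm v.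
Proof. exact: sqrtr_ge0. Qed.

Lemma disc0E {R : realType} (r : R) (v : 'cV[R]_2) :
  disc 0 r v = (euclidean_norm v < r).
Proof. by rewrite /disc /= subr0. Qed.

Lemma rotationE {R : realType} (theta : R) (v : 'cV[R]_2) (i : 'I_2) :
  rotation theta v i 0 =
    if i == 0 then cos theta * v 0 0 - sin theta * v 1 0
    else sin theta * v 0 0 + cos theta * v 1 0.
Proof.
rewrite /rotation mxE big_ord_recl big_ord1 !mxE.
have -> : lift ord0 ord0 = 1 :> 'I_2 by apply/val_inj.
case: (unliftP 0 i) => [j ->|->] /=; last by rewrite mulNr.
by rewrite (ord1 j).
Qed.

Lemma euclidean_norm_rotation {R : realType} (theta : R) (v : 'cV[R]_2) :
  euclidean_norm (rotation theta v) = euclidean_norm v.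
Proof.
rewrite /euclidean_norm !big_ord_recl !big_ord0 !rotationE /=.
have -> : lift ord0 ord0 = 1 :> 'I_2 by apply/val_inj.
congr Num.sqrt; have := cos2Dsin2 theta.
set c := cos theta; set s := sin theta; set x := v 0 0; set y := v 1 0 => cs.
transitivity ((c ^+ 2 + s ^+ 2) * (x ^+ 2 + y ^+ 2)); first by ring.
by rewrite cs; ring.
Qed.

Lemma rotationD {R : realType} (theta : R) (v w : 'cV[R]_2) :
  rotation theta (v + w) = rotation theta v + rotation theta w.
Proof. exact: mulmxDr. Qed.

Lemma rotation_sum {R : realType} (theta : R) (I : Type) (r : seq I)
    (F : I -> 'cV[R]_2) :
  rotation theta (\sum_(i <- r) F i) = \sum_(i <- r) rotation theta (F i).
Proof. exact: mulmx_sumr. Qed.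

(* Cayley-Hamilton for a rotation, of trace [2 cos theta] and determinant 1. *)
Lemma rotation2 {R : realType} (theta : R) (v : 'cV[R]_2) :
  rotation theta (rotation theta v) + v = (2 * cos theta) *: rotation theta v.
Proof.
apply/matrixP => i j; rewrite (ord1 j) [LHS]mxE [RHS]mxE !rotationE /=.
have cs : cos theta ^+ 2 = 1 - sin theta ^+ 2 by rewrite -(cos2Dsin2 theta) addrK.
have [->|->] : i = 0 \/ i = 1.
  by case: i => [[|[|n]]] // lt_i; [left|right]; apply/val_inj.
- by rewrite /=; ring: cs.
- by rewrite /=; ring: cs.
Qed.

(** By [rotation2], [v] is a function of its image: it equals [2 cos theta] times the image, minus
    the image rotated once more. *)
Lemma rotation_inj {R : realType} (theta : R) : injective (rotation theta).
Proof.
move=> v w e.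
have := rotation2 theta v; rewrite e -(rotation2 theta w) => /addrI.
by [].
Qed.

Lemma rotation_fixed {R : realType} (theta : R) (v : 'cV[R]_2) :
  cos theta != 1 -> rotation theta v = v -> v = 0.
Proof.
move=> c1 fixv; have := rotation2 theta v; rewrite !fixv => /eqP.
rewrite -subr_eq0 -{1 2}[v]scale1r -scalerDl -scalerBl scaler_eq0.
case/orP => [/eqP e|/eqP //]; case/eqP: c1; lra.
Qed.

(** * Locally finite sets stable under a rotation *)

Definition locally_finite {R : realType} (S : set 'cV[R]_2) :=
  forall r : R, finite_set (S `&` disc 0 r).

(** The orbit of [v] stays in [S] and on a circle about the origin, so two iterates coincide;
    injectivity cancels the smaller exponent. *)
Lemma rotation_periodic {R : realType} (theta : R) (S : set 'cV[R]_2)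
    (v : 'cV[R]_2) :
  locally_finite S -> (forall w, S w -> S (rotation theta w)) -> S v ->
  exists k, iter k.+1 (rotation theta) v = v.
Proof.
move=> finS rotS Sv.
have Siter n : S (iter n (rotation theta) v).
  by elim: n => //= n; exact: rotS.
have normiter n :
    euclidean_norm (iter n (rotation theta) v) = euclidean_norm v.
  by elim: n => //= n <-; exact: euclidean_norm_rotation.
have [|i [j [ltij eqij]]] := @finite_set_collision _ _
    (* The discs are open, hence the radius enlarged by 1. *)
    (fun n => iter n (rotation theta) v) (finS (euclidean_norm v + 1)).
  by move=> n; split=> //; rewrite disc0E normiter ltrDl.
exists (j - i).-1; rewrite prednK ?subn_gt0//.
have : iter i (rotation theta) v =
    iter i (rotation theta) (iter (j - i) (rotation theta) v).
  by rewrite -iterD subnKC// ltnW.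
elim: i {ltij eqij} (iter (j - i) _ v) => //= i IH w /rotation_inj.
exact: IH.
Qed.

(** A point of period [k.+1] is the image of its [k]-th iterate, which lies in [S]. *)
Lemma rotation_stable_eq {R : realType} (theta : R) (S : set 'cV[R]_2) :
  locally_finite S -> (forall w, S w -> S (rotation theta w)) ->
  rotation theta @` S = S.
Proof.
move=> finS rotS; apply/seteqP; split=> [_ [w Sw <-]|w Sw]; first exact: rotS.
have [k <-] := rotation_periodic theta S w finS rotS Sw.
exists (iter k (rotation theta) w) => //.
by elim: k => //= k; exact: rotS.
Qed.

(** * Translations mapping [S] into itself *)

Definition translations {R : realType} (S : set 'cV[R]_2) : set 'cV[R]_2 :=
  [set w | forall s, S s -> S (s + w)].

Lemma translations0 {R : realType} (S : set 'cV[R]_2) : translations S 0.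
Proof. by move=> s; rewrite addr0. Qed.

Lemma translationsD {R : realType} (S : set 'cV[R]_2) (v w : 'cV[R]_2) :
  translations S v -> translations S w -> translations S (v + w).
Proof. by move=> Sv Sw s Ss; rewrite addrA; apply/Sw/Sv. Qed.

(** For a fixed [s] in [S], the map [w => s + w] injects the short translations into the part of [S]
    near [s]. *)
Lemma translations_locally_finite {R : realType} (S : set 'cV[R]_2) :
  S !=set0 -> (forall c r, finite_set (S `&` disc c r)) ->
  locally_finite (translations S).
Proof.
move=> [s Ss] finS r.
apply: (@sub_finite_set _ _ ((fun w => s + w) @^-1` (S `&` disc s r))).
  move=> w [Mw]; rewrite disc0E => wr; split; first exact: Mw.
  by rewrite /disc /= addrAC subrr add0r.
by apply: finite_preimage (finS s r) => v w _ _ /addrI.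
Qed.

Lemma translations_rotation {R : realType} (theta : R) (S : set 'cV[R]_2)
    (w : 'cV[R]_2) :
  rotation theta @` S = S -> translations S w ->
  translations S (rotation theta w).
Proof.
move=> rotS Mw s; rewrite -rotS => -[u Su <-]; rewrite -rotationD.
by exists (u + w) => //; exact: Mw.
Qed.

Lemma rotation_stableN {R : realType} (theta : R) (M : set 'cV[R]_2)
    (w : 'cV[R]_2) :
  cos theta != 1 -> locally_finite M ->
  (forall v, M v -> M (rotation theta v)) ->
  M 0 -> (forall u v, M u -> M v -> M (u + v)) -> M w -> M (- w).
Proof.
move=> c1 finM rotM M0 MD Mw.
have [k perk] := rotation_periodic theta M w finM rotM Mw.
have Miter n : M (iter n (rotation theta) w).
  by elim: n => //= n; exact: rotM.
have sum0 : \sum_(0 <= i < k.+1) iter i (rotation theta) w = 0.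
  apply: (rotation_fixed theta) => //; rewrite rotation_sum.
  (* Rotating shifts the indices by one; the new last term, iterate [k.+1], is the old first term
     [w]. *)
  rewrite big_nat_recr// [RHS]big_nat_recl//= -[X in _ + X]/(iter k.+1 _ w) perk.
  by rewrite addrC.
move: sum0; rewrite big_nat_recl//= => /eqP.
(* Thus [- w] is the sum of the iterates 1 to [k]. *)
rewrite addrC addr_eq0 => /eqP <-.
by apply: (big_ind M) => // i _; exact: (Miter i.+1).
Qed.

Lemma rotation_stable_trace {R : realType} (theta : R) (M : set 'cV[R]_2)
    (w : 'cV[R]_2) :
  locally_finite M -> (forall v, M v -> M (rotation theta v)) ->
  (forall u v, M u -> M v -> M (u + v)) ->
  M w -> M ((2 * cos theta) *: w).
Proof.
move=> finM rotM MD Mw.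
have [k perk] := rotation_periodic theta M w finM rotM Mw.
have Miter n : M (iter n (rotation theta) w).
  by elim: n => //= n; exact: rotM.
(* By periodicity [iter k (rotation theta) w] is a preimage of [w] in [M]; Cayley-Hamilton is
   applied to it. *)
rewrite -perk /= -rotation2 -[rotation theta (rotation _ _)]/(iter k.+2 _ w).
by apply: MD; exact: Miter.
Qed.

Lemma locally_finite_scaler_int {R : realType} (t : R) (M : set 'cV[R]_2)
    (x : 'cV[R]_2) :
  locally_finite M -> (forall u v, M u -> M v -> M (u + v)) ->
  (forall v, M v -> M (- v)) -> (forall v, M v -> M (t *: v)) ->
  M x -> x != 0 -> t = (Num.floor t)%:~R.
Proof.
move=> finM MD MN Mt Mx x0.
have Mnat n v : M v -> M (v *+ n).
  elim: n => [|n IH] Mv; last by rewrite mulrS; apply/MD/IH.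
  by rewrite mulr0n -(subrr v); apply/MD/MN.
have Mint (m : int) v : M v -> M (m%:~R *: v).
  rewrite scaler_int; case: m => n Mv; first exact: Mnat.
  by rewrite NegzE mulrNz; apply/MN/Mnat.
have /andP[fl_le fl_gt] := floor_itv t.
move: fl_gt; rewrite intrD => fl_gt.
set f := t - (Num.floor t)%:~R.
have [f0 f1] : 0 <= f /\ f < 1 by rewrite /f; split; lra.
have Mf n : M (f ^+ n *: x).
  elim: n => [|n IH]; first by rewrite expr0 scale1r.
  rewrite exprS -scalerA /f scalerBl; apply: MD; first exact: Mt.
  exact/MN/Mint.
have [|i [j [ltij /eqP]]] := @finite_set_collision _ _
    (fun n => f ^+ n *: x) (finM (euclidean_norm x + 1)).
  move=> n; split=> //; rewrite disc0E euclidean_normZ.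
  rewrite ger0_norm ?exprn_ge0//.
  apply: (@le_lt_trans _ _ (euclidean_norm x)); last by rewrite ltrDl.
  by rewrite ler_piMl ?euclidean_norm_ge0// exprn_ile1// ltW.
rewrite -subr_eq0 -scalerBl scaler_eq0 (negPf x0) orbF subr_eq0.
(* If [f] is nonzero, its powers decrease strictly, contradicting the collision. *)
have [f00 _|fn0] := eqVneq f 0.
  by apply/eqP; rewrite -subr_eq0 -/f f00.
by rewrite gt_eqF// ltr_iXn2l// lt_neqAle eq_sym fn0.
Qed.

(** * Special values of the cosine *)

Lemma cos_pi_third {R : realType} : cos (pi / 3) = 2^-1 :> R.
Proof.
have := @cospi R.
have -> : pi = pi / 3 + pi / 3 + pi / 3 :> R by field.
have pi0 := @pi_gt0 R.
rewrite !cosD sinD; have := cos2Dsin2 (pi / 3 : R).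
have : 0 < cos (pi / 3) :> R by apply: cos_gt0_pihalf; apply/andP; split; lra.
(* The splitting of [pi] has also reached the [pi / 3] of the goal. *)
have -> : (pi / 3 + pi / 3 + pi / 3) / 3 = pi / 3 :> R by field.
set c := cos _; set s := sin _ => c0 cs e.
(* This factors the triple-angle equation [4 c^3 - 3 c = -1]; since [c > 0], only the double root
   remains. *)
have : (c + 1) * (2 * c - 1) ^+ 2 = 0 by rewrite -(subrr (-1)) -{2}e; nra.
move/eqP; rewrite mulf_eq0 gt_eqF ?addr_gt0//= sqrf_eq0 => /eqP; lra.
Qed.

Lemma cos_two_third_pi {R : realType} : cos (2 / 3 * pi) = - 2^-1 :> R.
Proof.
have -> : 2 / 3 * pi = - (pi / 3) + pi :> R by field.
by rewrite cosDpi cosN cos_pi_third.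
Qed.

Lemma cos_lt1 {R : realType} (theta : R) :
  0 < theta -> theta <= pi -> cos theta < 1.
Proof.
by move=> th0 thpi; rewrite -cos0 ltr_cos ?in_itv/= ?lexx ?pi_ge0// ltW.
Qed.

Lemma cos_half_int {R : realType} (theta : R) (m : int) :
  0 < theta -> theta <= pi -> 2 * cos theta = m%:~R ->
  [set pi / 3; pi / 2; 2 / 3 * pi; pi] theta.
Proof.
move=> th0 thpi cm; have pi0 := @pi_gt0 R.
have inj x : 0 <= x <= pi -> cos theta = cos x -> theta = x.
  by move=> xpi; apply: cos_inj; rewrite in_itv//= ltW.
have c1 := cos_lt1 theta th0 thpi.
have m_lt2 : m < 2 by rewrite -(ltr_int R) -cm; lra.
have m_geN2 : -2 <= m.
  by rewrite -(ler_int R) -cm; have := cos_geN1 theta; lra.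
have : [\/ m = -2, m = -1, m = 0 | m = 1].
  (* [Negz n] stands for [- (n + 1)], so the four cases come in the order 0, 1, -1, -2. *)
  case: m m_lt2 m_geN2 {cm} => [[|[|n]]|[|[|n]]] // _ _.
  - exact: Or43.
  - exact: Or44.
  - exact: Or42.
  - exact: Or41.
case=> e; rewrite e in cm.
- by right; apply: inj; rewrite ?cospi; lra.
- by left; right; apply: inj; rewrite ?cos_two_third_pi; lra.
- by left; left; right; apply: inj; rewrite ?cos_pihalf; lra.
- by left; left; left; apply: inj; rewrite ?cos_pi_third; lra.
Qed.

Theorem lemma3 (R : realType) (xbar : 'cV[R]_2) (theta : R)
    (S : set 'cV[R]_2)
    (xbar_neq0 : xbar != 0)
    (theta_gt0 : 0 < theta) (theta_le_pi : theta <= pi)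
    (S_neq0 : S !=set0)
    (S_locfin : forall (c : 'cV[R]_2) (r : R), finite_set (S `&` disc c r))
    (S_translate : translate S xbar `<=` S)
    (S_rotation : rotation theta @` S `<=` S) :
  [/\ translate S xbar = S,
      rotation theta @` S = S
    & [set pi / 3; pi / 2; 2 / 3 * pi; pi] theta].
Proof.
have c1 : cos theta != 1 by rewrite lt_eqF ?cos_lt1.
have rotS : rotation theta @` S = S.
  by apply: rotation_stable_eq => // w Sw; apply: S_rotation; exists w.
have finM := translations_locally_finite S S_neq0 S_locfin.
have rotM w := translations_rotation theta S w rotS.
have MD := translationsD S.
have MN w := rotation_stableN theta _ w c1 finM rotM (translations0 S) MD.
have Mx : translations S xbar by move=> s Ss; apply: S_translate; exists s.
split=> //.
(* The preimage [s - xbar] lies in [S] because [- xbar] is also a translation of [S] into itself. *)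
- apply/seteqP; split=> // s Ss; exists (s - xbar); last by rewrite subrK.
  exact: MN Mx s Ss.
- apply: (cos_half_int _ (Num.floor (2 * cos theta))) => //.
  apply: (locally_finite_scaler_int _ _ _ finM MD MN _ Mx xbar_neq0) => w.
  exact: (rotation_stable_trace theta (translations S) w finM rotM MD).
Qed.
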